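(* For any $3$-inflatable permutation $\tau$ of length $n$, $$n \equiv 0, 1, 17, 64, 80, \text{ or } 81 \pmod{144}.$$
   Context: A permutation of length $n\ge 1$ is a bijection of $[n]=\{1,\dots,n\}$; $S_n$ is the set of these and $|\tau|$ denotes the length of $\tau$. A tuple $(a_1,\dots,a_k)$ of distinct integers is order-isomorphic to $\pi\in S_k$ if $a_i<a_j \iff \pi(i)<\pi(j)$ for all $i,j$. The density $t(\pi,\tau)$ of $\pi\in S_k$ in a permutation $\tau$ with $|\tau|\ge k$ is the probability that the restriction of $\tau$ to a uniformly random $k$-element subset of its indices (listed in increasing order of index) is order-isomorphic to $\pi$. Tensor product: for $\tau\in S_n$, $\gamma\in S_m$, $\tau[\gamma]\in S_{nm}$ is given by $\tau[\gamma]((i-1)m+j)=(\tau(i)-1)m+\gamma(j)$ for $i\in[n]$, $j\in[m]$. The random inflation of $\tau$ is the sequence of random permutations $\tau[\lambda_1],\tau[\lambda_2],\ldots$, where $\lambda_\ell$ is uniformly distributed on $S_\ell$ for each $\ell\ge1$ (all on a common probability space). A sequence of permutations $\{\tau_j\}$ with $|\tau_j|\to\infty$ whose pattern densities $t(\pi,\tau_j)$ all converge is called $k$-symmetric if $\lim_{j} t(\pi,\tau_j)=1/k!$ for every $\pi\in S_k$. A permutation $\tau$ is $k$-inflatable if its random inflation is (almost surely) $k$-symmetric. *)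

(* Defs.v *)
From HB Require Import structures.
From mathcomp Require Import all_boot all_order all_algebra all_fingroup.
From mathcomp Require Import all_classical all_reals all_analysis.

Set Implicit Arguments.
Unset Strict Implicit.
Unset Printing Implicit Defensive.

Import Order.TTheory GRing.Theory Num.Theory.
Import numFieldNormedType.Exports.

Local Open Scope classical_set_scope.
Local Open Scope ring_scope.

(* A permutation of length n is an element of 'S_n = {perm 'I_n}: positions
   and values are numbered from 0 instead of 1. *)

Definition order_isomorphic (k : nat) (a : 'I_k -> nat) (pi : 'S_k) : bool :=
  [forall i, forall j, (a i < a j)%N == (pi i < pi j)%N].

(* enum A lists the elements of A in increasing order.  The default value 0 of
   nth is only reached when #|A| < k. *)
Definition restriction (N k : nat) (tau : 'S_N) (A : {set 'I_N}) : 'I_k -> nat :=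
  fun i => nth 0%N [seq nat_of_ord (tau x) | x <- enum A] i.

(* The value for N < k is 0 by the convention x / 0 = 0. *)
Definition density (R : realType) (k N : nat) (pi : 'S_k) (tau : 'S_N) : R :=
  #|[set A : {set 'I_N} |
      (#|A| == k) && order_isomorphic (restriction tau A) pi]%SET|%:R
  / 'C(N, k)%:R.

Section TensorProduct.
Context (n m : nat).

Fact tensor_div_subproof (x : 'I_(n * m)) : (x %/ m < n)%N.
Proof.
case: m x => [|p] x; first by case: x => x; rewrite muln0.
by rewrite ltn_divLR.
Qed.

Fact tensor_mod_subproof (x : 'I_(n * m)) : (x %% m < m)%N.
Proof.
case: m x => [|p] x; first by case: x => x; rewrite muln0.
by rewrite ltn_mod.
Qed.

Fact tensor_subproof (i : 'I_n) (j : 'I_m) : (i * m + j < n * m)%N.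
Proof.
have := leq_mul (ltn_ord i) (leqnn m); apply: leq_trans.
by rewrite mulSn addnC ltn_add2r.
Qed.

Definition tensor_fun (tau : 'S_n) (gamma : 'S_m) (x : 'I_(n * m)) :
    'I_(n * m) :=
  Ordinal (tensor_subproof (tau (Ordinal (tensor_div_subproof x)))
                           (gamma (Ordinal (tensor_mod_subproof x)))).

Fact tensor_fun_inj (tau : 'S_n) (gamma : 'S_m) :
  injective (tensor_fun tau gamma).
Proof.
move=> x y /(congr1 val) /= e.
have m0 : (0 < m)%N by apply: leq_trans (tensor_mod_subproof x).
have uniq_divmod (a b : nat) (c d : 'I_m) :
    (a * m + c = b * m + d)%N -> a = b /\ c = d.
  move=> E; have := congr1 (modn^~ m) E; rewrite /= !modnMDl !modn_small //.
  move=> /val_inj cd; split=> //; move/eqP: E.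
  by rewrite cd eqn_add2r eqn_pmul2r // => /eqP.
have [/val_inj/perm_inj/(congr1 val)/= ed /perm_inj/(congr1 val)/= em] :=
  uniq_divmod _ _ _ _ e.
by apply: val_inj; rewrite /= (divn_eq x m) (divn_eq y m) ed em.
Qed.

Definition tensor (tau : 'S_n) (gamma : 'S_m) : 'S_(n * m) :=
  perm (@tensor_fun_inj tau gamma).

Lemma tensorE (tau : 'S_n) (gamma : 'S_m) (i : 'I_n) (j : 'I_m) :
  tensor tau gamma (Ordinal (tensor_subproof i j))
  = Ordinal (tensor_subproof (tau i) (gamma j)).
Proof.
have m0 : (0 < m)%N by apply: leq_ltn_trans (ltn_ord j).
rewrite permE; apply: val_inj => /=.
congr (val (tau _) * m + val (gamma _))%N; apply: val_inj => /=.
  by rewrite divnMDl // divn_small // addn0.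
by rewrite modnMDl modn_small.
Qed.

End TensorProduct.

Definition k_symmetric (R : realType) (k : nat) (len : nat -> nat)
    (s : forall j, 'S_(len j)) : Prop :=
  [/\ len @ \oo --> \oo,
      forall (l : nat) (pi : 'S_l), (0 < l)%N ->
        cvgn (fun j => density R pi (s j))
    & forall pi : 'S_k,
        (fun j => density R pi (s j)) @ \oo --> (k`!%:R^-1 : R)].

(* 'S_l is finite: measurability of the fibres is measurability for the
   discrete sigma-algebra. *)
Definition uniform_permutation (R : realType) (d : measure_display)
    (Omega : measurableType d) (P : probability Omega R)
    (l : nat) (X : Omega -> 'S_l) : Prop :=
  forall s : 'S_l,
    measurable (X @^-1` [set s]) /\ P (X @^-1` [set s]) = (l`!%:R^-1)%:E.

(* The term of index j is tau[lambda_(j+1)]; the sequence starts with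
   lambda_1. *)
Definition random_inflation (n : nat) (tau : 'S_n) (Omega : Type)
    (lambda : forall l, Omega -> 'S_l) (w : Omega) :
    forall j : nat, 'S_(n * j.+1) :=
  fun j => tensor tau (lambda j.+1 w).

(* The joint law of the lambda_l is left free, hence the quantification over
   probability spaces carrying such a sequence. It is existential, which is the
   weakest reading of inflatability. *)
Definition inflatable (R : realType) (k n : nat) (tau : 'S_n) : Prop :=
  exists (d : measure_display) (Omega : measurableType d)
      (P : probability Omega R) (lambda : forall l, Omega -> 'S_l),
    (forall l : nat, (0 < l)%N -> uniform_permutation P (lambda l)) /\
    {ae P, forall w, k_symmetric R k (random_inflation tau lambda w)}.

(* Main.v *)
Require Import Defs.
From HB Require Import structures.
From mathcomp Require Import all_boot all_order all_algebra all_fingroup.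
From mathcomp Require Import all_classical all_reals all_analysis.
From mathcomp Require Import measurable_realfun.
From mathcomp Require Import ring lra zify.

(** Let P be the number of noninversions (occurrences of 12) of tau and N its
    number of occurrences of 132. Inflatability determines both as functions of n,
    and the integrality of N restricts n modulo 144.

    Densities are bounded, so almost sure convergence of the densities of
    tau[lambda_m] to 1/6 gives the same limit for their means over a uniform
    lambda_m ([mean_cvg]). Only these means are used. They are explicit: the
    positions of tau[s] are divided into n intervals of length m, here called
    cells, and sorting the occurrences of 132 in tau[s] by the cells that they
    meet shows ([occurrences132_tensor]) that their number is
      m^3 N + m P inv(s) + n N(s),
    and the means over s of inv(s) and of N(s) are m (m - 1) / 4 and
    C(m, 3) / 6, since all patterns are equally likely at any fixed set of
    positions ([equidistribution]). As m grows, comparing with C(nm, 3) / 6 gives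
      36 N + 9 P + n = n^3      ([inflatable_occurrences132]).

    A second relation determines P. Counting noninversions inside triples
    ([sum_noninversions3_occurrences]) expresses the density of 12 through the
    densities of the patterns of length 3, so it tends to 1/2. Its mean is
    explicit too ([noninversions_tensor]), which gives
      4 P + n = n^2             ([inflatable_noninversions]).

    Eliminating P yields 144 N = n (n - 1) (4 n - 5), and the residues are those
    of the solutions of this congruence ([residues_mod_144]). *)

(** * Patterns of sequences and their equidistribution *)

Section Patterns.
Local Set Implicit Arguments.
Local Unset Strict Implicit.

Lemma order_isomorphicP (k : nat) (f : 'I_k -> nat) (p : 'S_k) :
  reflect (forall i j, (f i < f j) = (p i < p j)) (order_isomorphic f p).
Proof.
exact: 'forall_'forall_eqP.
Qed.

(** An injective f : 'I_k -> nat and the permutation it is order-isomorphic to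
    have the same ranks, and a permutation is its own rank function. This gives
    both existence and uniqueness of the pattern of f. *)
Definition rank (k : nat) (f : 'I_k -> nat) (i : 'I_k) : nat :=
  #|[set j | f j < f i]|.

Lemma rank_perm (k : nat) (p : 'S_k) (i : 'I_k) : rank (fun j => p j) i = p i.
Proof.
rewrite /rank -(card_imset _ (@perm_inj _ p)).
rewrite (_ : imset _ _ = [set v : 'I_k | v < p i]); last first.
  apply/setP=> v; rewrite inE; apply/imsetP/idP => [[j]|lt_v].
    by rewrite inE => lt_j ->.
  by exists (p^-1%g v); rewrite ?inE permKV.
by rewrite -sum1dep_card (big_ord_narrow (ltnW (ltn_ord (p i)))) sum1_card card_ord.
Qed.

Lemma order_isomorphic_rank (k : nat) (f : 'I_k -> nat) (p : 'S_k) :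
  order_isomorphic f p -> forall i, rank f i = p i.
Proof.
move=> /order_isomorphicP fp i; rewrite -rank_perm; apply: eq_card => j.
by rewrite !inE fp.
Qed.

Lemma order_isomorphic_uniq (k : nat) (f : 'I_k -> nat) (p q : 'S_k) :
  order_isomorphic f p -> order_isomorphic f q -> p = q.
Proof.
move=> /order_isomorphic_rank fp /order_isomorphic_rank fq.
by apply/permP => i; apply: val_inj; rewrite /= -fp -fq.
Qed.

Lemma ltn_rank (k : nat) (f : 'I_k -> nat) (i j : 'I_k) :
  (rank f i < rank f j) = (f i < f j).
Proof.
have mono a b : f a <= f b -> rank f a <= rank f b.
  move=> le_ab; apply/subset_leq_card/fintype.subsetP=> x; rewrite !inE => lt_xa.
  exact: leq_trans lt_xa le_ab.
have [le_ji|lt_ij] := leqP (f j) (f i); first by rewrite ltnNge mono.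
apply: proper_card; rewrite properE; apply/andP; split.
  by apply/fintype.subsetP=> x; rewrite !inE => /ltn_trans; apply.
by apply/fintype.subsetPn; exists i; rewrite !inE ?ltnn.
Qed.

Lemma order_isomorphic_exists (k : nat) (f : 'I_k -> nat) :
  injective f -> exists p : 'S_k, order_isomorphic f p.
Proof.
move=> f_inj.
have rank_lt i : rank f i < k.
  rewrite -[X in _ < X]card_ord -cardsT; apply: proper_card.
  rewrite properT; apply/eqP => /setP/(_ i); by rewrite !inE ltnn.
have rank_inj : injective (fun i => Ordinal (rank_lt i)).
  move=> i j /(congr1 val) /= e; apply: f_inj.
  by case: (ltngtP (f i) (f j)) => //; rewrite -(ltn_rank f) e ltnn.
by exists (perm rank_inj); apply/order_isomorphicP => i j; rewrite !permE /= ltn_rank.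
Qed.

Lemma sum_order_isomorphic (k : nat) (f : 'I_k -> nat) : injective f ->
  \sum_(p : 'S_k) order_isomorphic f p = 1.
Proof.
move=> /order_isomorphic_exists[p fp].
rewrite (bigD1 p) //= fp big1 // => q; apply: contraNeq; rewrite eqb0 negbK.
by move=> fq; rewrite (order_isomorphic_uniq fq fp).
Qed.

Lemma order_isomorphic_permute (k : nat) (f : 'I_k -> nat) (sigma p : 'S_k) :
  order_isomorphic (fun i => f (sigma i)) (sigma * p)%g = order_isomorphic f p.
Proof.
apply/order_isomorphicP/order_isomorphicP => h i j; last by rewrite !permM h.
by have := h ((sigma^-1)%g i) ((sigma^-1)%g j); rewrite !permM !permKV.
Qed.

(** The permutations sigma that extend along f form a submonoid, and it contains
    every transposition because f carries [tperm a b] to [tperm (f a) (f b)]. *)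
Lemma extend_perm (k m : nat) (f : 'I_k -> 'I_m) (sigma : 'S_k) : injective f ->
  exists q : 'S_m, forall i, q (f i) = f (sigma i).
Proof.
move=> f_inj; have [ts -> _] := prod_tpermP sigma.
elim: ts => [|t ts [q hq]]; first by exists 1%g => i; rewrite big_nil !perm1.
exists (tperm (f t.1) (f t.2) * q)%g => i.
by rewrite big_cons !permM -hq -inj_tperm.
Qed.

(** Precomposing s with an extension of sigma is a bijection of 'S_m which sends
    the s with pattern p at f to the s with pattern [sigma * p] there. So the k!
    patterns are equally frequent, and every s has exactly one of them. *)
Lemma equidistribution (k m : nat) (f : 'I_k -> 'I_m) (p : 'S_k) :
  injective f ->
  (\sum_(s : 'S_m) order_isomorphic (fun i => s (f i)) p) * k`! = m`!.
Proof.
move=> f_inj.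
pose c p := \sum_(s : 'S_m) order_isomorphic (fun i => s (f i)) p.
have c_permute sigma q : c (sigma * q)%g = c q.
  have [g fg] := extend_perm sigma f_inj.
  rewrite /c (reindex_inj (mulgI g)) /=; apply: eq_bigr => s _; congr nat_of_bool.
  rewrite -(order_isomorphic_permute (fun i => s (f i)) sigma).
  by congr order_isomorphic; apply/funext => i; rewrite permM fg.
have sum_c : \sum_(q : 'S_k) c q = m`!.
  rewrite exchange_big /= -card_Sn -sum1_card; apply: eq_bigr => s _.
  by apply: sum_order_isomorphic => i j /val_inj/perm_inj/f_inj.
rewrite -/(c p) -sum_c (eq_bigr (fun=> c p)).
  by rewrite sum_nat_const card_Sn mulnC.
by move=> q _; rewrite -(c_permute (p * q^-1)%g q) mulgKV.
Qed.

(** Exchanging the values at a and b pairs the s with [s a < s b] with the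
    others. *)
Lemma sum_perm_lt (m : nat) (a b : 'I_m) : a != b ->
  (\sum_(s : 'S_m) (s a < s b)) * 2 = m`!.
Proof.
move=> neq_ab; rewrite muln2 -addnn.
rewrite [X in _ + X = _](reindex_inj (mulgI (tperm a b))) /= -big_split /=.
rewrite -card_Sn -sum1_card; apply: eq_bigr => s _.
rewrite !permM tpermL tpermR; have : s a != s b by rewrite (inj_eq perm_inj).
by rewrite -val_eqE /=; case: ltngtP.
Qed.

End Patterns.

(** * Occurrences of patterns in a permutation *)

Section Occurrences.
Local Set Implicit Arguments.
Local Unset Strict Implicit.

Definition occurrences (k N : nat) (p : 'S_k) (T : 'S_N) : nat :=
  #|[set A : {set 'I_N} | (#|A| == k) && order_isomorphic (restriction T A) p]|.

Lemma occurrencesE (k N : nat) (p : 'S_k) (T : 'S_N) :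
  occurrences p T =
  \sum_(A : {set 'I_N} | #|A| == k) order_isomorphic (restriction T A) p.
Proof.
by rewrite /occurrences -sum1dep_card big_mkcondr; apply: eq_bigr => A _; case: ifP.
Qed.

Lemma leq_occurrences (k N : nat) (p : 'S_k) (T : 'S_N) :
  occurrences p T <= 'C(N, k).
Proof.
rewrite -[X in 'C(X, _)]card_ord -card_draws.
by apply/subset_leq_card/fintype.subsetP => A; rewrite !inE => /andP[].
Qed.

(** Through an enumeration of A that does not depend on T, restrictions become
    compositions, to which equidistribution applies. *)
Lemma restriction_inj (k N : nat) (A : {set 'I_N}) : #|A| = k ->
  exists2 f : 'I_k -> 'I_N, injective f &
    forall T : 'S_N, restriction T A = fun i => T (f i) :> nat.
Proof.
case: _ / => {k}; exists (@enum_val _ (mem A)); first exact: enum_val_inj.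
move=> T; apply/funext => i; rewrite /restriction.
by rewrite (nth_map (enum_val i)) -?cardE // -enum_val_nth.
Qed.

Lemma sum_occurrences (k m : nat) (p : 'S_k) :
  (\sum_(s : 'S_m) occurrences p s) * k`! = m`! * 'C(m, k).
Proof.
under eq_bigr do rewrite occurrencesE.
rewrite exchange_big /= big_distrl /= -[X in 'C(X, _)](card_ord m) -card_draws.
rewrite -sum1dep_card big_distrr /=; apply: eq_bigr => A /eqP/restriction_inj[f f_inj fE].
rewrite muln1 -(equidistribution p f_inj); congr (_ * _).
by apply: eq_bigr => s _; rewrite fE.
Qed.

Lemma sorted_enum_ord (N : nat) (A : {set 'I_N}) :
  sorted (fun a b : 'I_N => a < b) (enum A).
Proof.
rewrite /enum_mem; apply: sorted_filter; first by move=> a b c; apply: ltn_trans.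
by rewrite -enumT -(sorted_map (e' := ltn) (f := val)) val_enum_ord iota_ltn_sorted.
Qed.

Lemma enum_set3 (N : nat) (x y z : 'I_N) : x < y -> y < z ->
  enum [set x; y; z] = [:: x; y; z].
Proof.
move=> xy yz; apply: (@sorted_eq _ (fun a b : 'I_N => a < b)).
- by move=> a b c; apply: ltn_trans.
- by move=> a b; rewrite ltnNge => /andP[/negP nle /ltnW].
- exact: sorted_enum_ord.
- by rewrite /= xy yz.
apply: uniq_perm; first exact: enum_uniq.
  by rewrite /= !inE -!val_eqE /= negb_or !ltn_eqF // (ltn_trans xy).
by move=> a; rewrite mem_enum !inE orbA.
Qed.

(** A set of three positions is the same thing as its increasing enumeration. *)
Lemma sum_set3 (N : nat) (F : {set 'I_N} -> nat) :
  \sum_(A : {set 'I_N} | #|A| == 3) F A =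
  \sum_(x < N) \sum_(y < N) \sum_(z < N) (x < y < z) * F [set x; y; z].
Proof.
pose h (t : 'I_N * 'I_N * 'I_N) := [set t.1.1; t.1.2; t.2].
pose D := [set t : 'I_N * 'I_N * 'I_N | t.1.1 < t.1.2 < t.2].
have h_enum t : t \in D -> enum (h t) = [:: t.1.1; t.1.2; t.2].
  by rewrite inE => /andP[]; apply: enum_set3.
have h_inj : {in D &, injective h}.
  move=> t u tD uD e; have := h_enum _ uD; rewrite -e h_enum // => -[].
  by case: t u {tD uD e} => [[? ?] ?] [[? ?] ?] /= -> -> ->.
have h_im : [set A : {set 'I_N} | #|A| == 3] = h @: D.
  apply/setP => A; rewrite inE; apply/idP/imsetP => [|[t tD ->]]; last first.
    by rewrite cardE h_enum.
  rewrite cardE.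
  have := sorted_enum_ord A.
  have : A =i enum A by move=> a; rewrite mem_enum.
  case: (enum A) => [|x [|y [|z [|]]]] //= Ae /and3P[xy yz _] _.
  exists (x, y, z); first by rewrite inE /= xy.
  by apply/setP => a; rewrite Ae !inE orbA.
transitivity (\sum_(A in [set A : {set 'I_N} | #|A| == 3]) F A).
  by apply: eq_bigl => A; rewrite inE.
rewrite h_im big_imset //= (eq_bigl (fun t : 'I_N * 'I_N * 'I_N => t.1.1 < t.1.2 < t.2)); last first.
  by move=> t; rewrite inE.
rewrite big_mkcond pair_bigA pair_bigA; apply: eq_bigr => -[[x y] z] _ /=.
by case: ifP => _; rewrite ?mul1n.
Qed.

Lemma ord3P (i : 'I_3) : [\/ i = inord 0, i = inord 1 | i = inord 2].
Proof.
by case: i => -[|[|[|]]] // lt_i; [constructor 1|constructor 2|constructor 3];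
  apply: val_inj; rewrite /= inordK.
Qed.

(** The permutation 132 in one-line notation. *)
Definition pattern132 : 'S_3 := tperm (inord 1) (inord 2).

Lemma pattern132P (f : 'I_3 -> nat) :
  order_isomorphic f pattern132 =
  (f (inord 0) < f (inord 2) < f (inord 1)).
Proof.
have p0 : pattern132 (inord 0) = inord 0 by rewrite tpermD // -val_eqE /= !inordK.
have p1 : pattern132 (inord 1) = inord 2 by rewrite tpermL.
have p2 : pattern132 (inord 2) = inord 1 by rewrite tpermR.
apply/order_isomorphicP/idP => [h|/andP[h1 h2] i j].
  by rewrite !h p0 p1 p2 !inordK.
have h3 := ltn_trans h1 h2.
by case: (ord3P i) => ->; case: (ord3P j) => ->; rewrite ?p0 ?p1 ?p2 !inordK //=;
  rewrite ?ltnn ?h1 ?h2 ?h3 // ltnNge ltnW.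
Qed.

Lemma restriction3 (N : nat) (T : 'S_N) (x y z : 'I_N) : x < y -> y < z ->
  let f := restriction T [set x; y; z] : 'I_3 -> nat in
  [/\ f (inord 0) = T x, f (inord 1) = T y & f (inord 2) = T z].
Proof. by move=> xy yz /=; rewrite /restriction enum_set3 //= !inordK. Qed.

Lemma occurrences132 (N : nat) (T : 'S_N) :
  occurrences pattern132 T =
  \sum_(x < N) \sum_(y < N) \sum_(z < N) [&& x < y, y < z, T x < T z & T z < T y].
Proof.
rewrite occurrencesE sum_set3; apply: eq_bigr => x _; apply: eq_bigr => y _.
apply: eq_bigr => z _; rewrite pattern132P andbA.
have [/andP[xy yz]|] := boolP (x < y < z); last by rewrite mul0n.
by have [-> -> ->] := restriction3 T xy yz; rewrite mul1n.
Qed.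

Definition noninversions (N : nat) (T : 'S_N) : nat :=
  \sum_(x < N) \sum_(y < N) (x < y) && (T x < T y).

(** [noninversions] for three increasing positions, applicable both to a pattern
    and to a restriction, whose values need not lie in 'I_3. *)
Definition noninversions3 (f : 'I_3 -> nat) : nat :=
  (f (inord 0) < f (inord 1)) + (f (inord 0) < f (inord 2)) +
  (f (inord 1) < f (inord 2)).

Lemma sum_noninversions3 : \sum_(p : 'S_3) noninversions3 (fun i => p i) = 9.
Proof.
rewrite 2!big_split /=.
have ltE (i j : nat) : i < 3 -> j < 3 -> i != j ->
    \sum_(p : 'S_3) (p (inord i) < p (inord j)) = 3.
  move=> i3 j3 ij; have /sum_perm_lt : (inord i : 'I_3) != inord j.
    by rewrite -val_eqE /= !inordK.
  by move=> /eqP; rewrite -[3`!]/(3 * 2) eqn_pmul2r // => /eqP.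
by rewrite !ltE.
Qed.

Lemma restriction_noninversions3 (N : nat) (T : 'S_N) (A : {set 'I_N}) :
  #|A| = 3 ->
  \sum_(p : 'S_3)
    noninversions3 (fun i => p i) * order_isomorphic (restriction T A) p =
  noninversions3 (restriction T A).
Proof.
move=> /restriction_inj[f f_inj fE].
have f'_inj : injective (restriction T A : 'I_3 -> nat).
  by rewrite fE => i j /val_inj/perm_inj/f_inj.
rewrite -[RHS]muln1 -[X in _ = _ * X](sum_order_isomorphic f'_inj).
rewrite big_distrr /=; apply: eq_bigr => p _.
by case: order_isomorphicP => [h|]; rewrite ?muln0 // /noninversions3 !h.
Qed.

(** Double counting of the pairs (noninversion of T, third position): each
    noninversion lies in N - 2 sets of three positions. The subtraction is moved
    to the other side so that the identity also makes sense for N < 2. *)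
Lemma sum_noninversions3_occurrences (N : nat) (T : 'S_N) :
  \sum_(p : 'S_3) noninversions3 (fun i => p i) * occurrences p T +
    2 * noninversions T =
  N * noninversions T.
Proof.
under [X in X + _]eq_bigr do rewrite occurrencesE big_distrr /=.
rewrite exchange_big /= (eq_bigr _ (fun A cA => restriction_noninversions3 T (eqP cA))).
rewrite sum_set3.
transitivity (\sum_(x < N) \sum_(y < N) \sum_(z < N)
  ([&& x < y, y < z & T x < T y] + [&& x < y, y < z & T x < T z] +
   [&& x < y, y < z & T y < T z]) + 2 * noninversions T).
  congr (_ + _); apply: eq_bigr => x _; apply: eq_bigr => y _; apply: eq_bigr => z _.
  have [xy|] := boolP (x < y); last by rewrite mul0n.
  have [yz|] := boolP (y < z); last by rewrite mul0n.
  by rewrite /noninversions3 mul1n; have [-> -> ->] := restriction3 T xy yz.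
(* For a noninversion (x, y), the third position z is to the right of both, in
   between, or to the left of both. *)
transitivity (\sum_(x < N) \sum_(y < N) ((x < y) && (T x < T y)) *
    \sum_(z < N) ((y < z) + (x < z < y) + (z < x)) +
    2 * noninversions T).
  congr (_ + _).
  under eq_bigr do under eq_bigr do rewrite 2!big_split /=.
  under eq_bigr do rewrite 2!big_split /=.
  under [RHS]eq_bigr do under eq_bigr do rewrite 2!big_split /= !mulnDr !big_distrr /=.
  under [RHS]eq_bigr do rewrite 2!big_split /=.
  rewrite !big_split /=; congr (_ + _ + _).
  - apply: eq_bigr => x _; apply: eq_bigr => y _; apply: eq_bigr => z _.
    by rewrite mulnb; congr nat_of_bool; lia.
  - apply: eq_bigr => x _; rewrite exchange_big /=; apply: eq_bigr => y _.
    apply: eq_bigr => z _.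
    by rewrite mulnb; congr nat_of_bool; lia.
  - rewrite exchange_big /=; under eq_bigr do rewrite exchange_big /=.
    apply: eq_bigr => y _; apply: eq_bigr => z _; apply: eq_bigr => x _.
    by rewrite mulnb; congr nat_of_bool; lia.
rewrite /noninversions !big_distrr -big_split; apply: eq_bigr => x _ /=.
rewrite !big_distrr -big_split; apply: eq_bigr => y _ /=.
have [/andP[xy _]|_] := boolP (_ && _); last by rewrite !muln0 mul0n.
rewrite !muln1 mul1n -[RHS]card_ord -sum1_card.
have neq_yx : y != x by rewrite -val_eqE /= gtn_eqF.
rewrite (bigD1 x) // [RHS](bigD1 x) // (bigD1 y) // [X in _ = _ + X](bigD1 y) //=.
rewrite (eq_bigr (fun=> 1)); first by rewrite !ltnn; lia.
by move=> z /andP[zx zy]; move: zx zy; rewrite -!val_eqE /=; lia.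
Qed.

End Occurrences.

(** * Pairs and triples of positions in a tensor product *)

Section Pairs.
Local Set Implicit Arguments.
Local Unset Strict Implicit.

Definition inversions (N : nat) (T : 'S_N) : nat :=
  \sum_(x < N) \sum_(y < N) (x < y) && (T y < T x).

Lemma sum_ltn_ord (m : nat) : (\sum_(x < m) \sum_(y < m) (x < y)) * 2 = m * m.-1.
Proof.
rewrite muln2 -addnn [X in _ + X = _]exchange_big -big_split /=.
rewrite -[X in X * _]card_ord -sum_nat_const; apply: eq_bigr => x _.
rewrite -big_split /=.
have /(congr1 predn) : \sum_(y < m) 1 = m by rewrite sum1_card card_ord.
rewrite (bigD1 x) //= => <-; rewrite (bigD1 x) //= !ltnn !add0n.
by apply: eq_bigr => y; rewrite -val_eqE /=; lia.
Qed.

Lemma sum_noninversions (m : nat) :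
  (\sum_(s : 'S_m) noninversions s) * 4 = m`! * (m * m.-1).
Proof.
rewrite -sum_ltn_ord mulnA -[4]/(2 * 2) mulnA; congr (_ * 2).
rewrite exchange_big big_distrl big_distrr /=; apply: eq_bigr => x _.
rewrite exchange_big big_distrl big_distrr /=; apply: eq_bigr => y _.
have [xy|] := boolP (x < y); last by rewrite big1 ?muln0.
by rewrite muln1 -(@sum_perm_lt _ x y) // -val_eqE /= ltn_eqF.
Qed.

Lemma sum_inversions (m : nat) :
  (\sum_(s : 'S_m) inversions s) * 4 = m`! * (m * m.-1).
Proof.
rewrite -sum_ltn_ord mulnA -[4]/(2 * 2) mulnA; congr (_ * 2).
rewrite exchange_big big_distrl big_distrr /=; apply: eq_bigr => x _.
rewrite exchange_big big_distrl big_distrr /=; apply: eq_bigr => y _.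
have [xy|] := boolP (x < y); last by rewrite big1 ?muln0.
by rewrite muln1 -(@sum_perm_lt _ y x) // -val_eqE /= gtn_eqF.
Qed.

End Pairs.

Section Tensor.
Local Set Implicit Arguments.
Local Unset Strict Implicit.
Context (n m : nat).

Definition cell (i : 'I_n) (a : 'I_m) : 'I_(n * m) := Ordinal (tensor_subproof i a).

Lemma ltn_cell (i j : 'I_n) (a b : 'I_m) :
  (cell i a < cell j b) = (i < j) || (i == j) && (a < b).
Proof.
rewrite -val_eqE /=; have := ltn_ord a; have := ltn_ord b.
case: (ltngtP i j) => [ij|ji|->] bm am /=; last by rewrite ltn_add2l.
- have := leq_mul ij (leqnn m); rewrite mulSn; lia.
- have := leq_mul ji (leqnn m); rewrite mulSn; lia.
Qed.

Lemma sum_cell (F : 'I_(n * m) -> nat) :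
  \sum_x F x = \sum_i \sum_a F (cell i a).
Proof.
rewrite pair_bigA /= (reindex (fun p : 'I_n * 'I_m => cell p.1 p.2)) //.
exists (fun x => (Ordinal (tensor_div_subproof x), Ordinal (tensor_mod_subproof x))).
  move=> [i a] _; congr pair; apply: val_inj => /=.
    by rewrite divnMDl ?divn_small ?addn0 //; apply: leq_ltn_trans (ltn_ord a).
  by rewrite modnMDl modn_small.
by move=> x _; apply: val_inj; rewrite /= -divn_eq.
Qed.

Lemma sum_cell2 (F : 'I_(n * m) -> 'I_(n * m) -> nat) :
  \sum_x \sum_y F x y = \sum_i \sum_j \sum_a \sum_b F (cell i a) (cell j b).
Proof.
rewrite sum_cell; apply: eq_bigr => i _.
by under eq_bigr do rewrite sum_cell; rewrite exchange_big.
Qed.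

Lemma sum_cell3 (F : 'I_(n * m) -> 'I_(n * m) -> 'I_(n * m) -> nat) :
  \sum_x \sum_y \sum_z F x y z =
  \sum_i \sum_j \sum_k \sum_a \sum_b \sum_c F (cell i a) (cell j b) (cell k c).
Proof.
rewrite sum_cell2; apply: eq_bigr => i _; apply: eq_bigr => j _.
under eq_bigr do under eq_bigr do rewrite sum_cell.
under eq_bigr do rewrite exchange_big /=.
by rewrite exchange_big.
Qed.

Lemma sum_cst2 (x : nat) : \sum_(a < m) \sum_(b < m) x = m ^ 2 * x.
Proof. by rewrite !sum_nat_const !card_ord; lia. Qed.

Lemma sum_cst3 (x : nat) : \sum_(a < m) \sum_(b < m) \sum_(c < m) x = m ^ 3 * x.
Proof. by rewrite !sum_nat_const !card_ord; lia. Qed.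

(** Two positions lie in distinct cells, where tau decides, or in the same one,
    where s does. *)
Lemma noninversions_tensor (tau : 'S_n) (s : 'S_m) :
  noninversions (tensor tau s) = m ^ 2 * noninversions tau + n * noninversions s.
Proof.
have -> : n * noninversions s = \sum_(i < n) \sum_(j < n | j == i) noninversions s.
  under eq_bigr do rewrite big_pred1_eq.
  by rewrite sum_nat_const card_ord.
rewrite /noninversions sum_cell2 big_distrr -big_split; apply: eq_bigr => i _ /=.
rewrite big_distrr [X in _ + X]big_mkcond -big_split; apply: eq_bigr => j _ /=.
rewrite -sum_cst2; case: eqVneq => [->|ji]; last rewrite addn0.
  rewrite [X in X + _]big1 ?add0n; last by move=> a _; rewrite big1 // => b _; rewrite ltnn.
  apply: eq_bigr => a _; apply: eq_bigr => b _.
  by rewrite !tensorE !ltn_cell !ltnn !eqxx.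
apply: eq_bigr => a _; apply: eq_bigr => b _.
rewrite !tensorE !ltn_cell (inj_eq perm_inj) eq_sym (negPf ji).
by rewrite !orbF.
Qed.

(** The three entries of an occurrence of 132 lie in three distinct cells, or in
    a single one, or in two. In the last case the entries that share a cell are
    consecutive both in position and in value relative to the third entry, which
    leaves only the pair 32: it is an inversion of s in the right cell of a
    noninversion of tau, and the remaining entry is free in the left cell. *)
Lemma occurrences132_tensor (tau : 'S_n) (s : 'S_m) :
  occurrences pattern132 (tensor tau s) =
  m ^ 3 * occurrences pattern132 tau + m * noninversions tau * inversions s +
  n * occurrences pattern132 s.
Proof.
have -> : m * noninversions tau * inversions s =
    \sum_(i < n) \sum_(j < n) \sum_(k < n)
      ((k == j) && (i < j) && (tau i < tau j)) * (m * inversions s).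
  rewrite [m * _]mulnC -mulnA /noninversions !big_distrl; apply: eq_bigr => i _.
  rewrite !big_distrl; apply: eq_bigr => j _ /=.
  rewrite (bigD1 j) //= eqxx /= big1 ?addn0 //.
  by move=> k /negPf ->.
have -> : n * occurrences pattern132 s =
    \sum_(i < n) \sum_(j < n) \sum_(k < n)
      ((k == j) && (j == i)) * occurrences pattern132 s.
  rewrite -[X in X * _ = _]card_ord -sum1_card big_distrl; apply: eq_bigr => i _ /=.
  rewrite (bigD1 i) //= (bigD1 i) //= !eqxx mul1n /= !big1 ?addn0 //.
    by move=> j /negPf ->; rewrite big1 // => k _; rewrite andbF.
  by move=> k /negPf ->.
rewrite !occurrences132 sum_cell3 big_distrr -!big_split; apply: eq_bigr => i _ /=.
rewrite big_distrr -!big_split; apply: eq_bigr => j _ /=.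
rewrite big_distrr -!big_split; apply: eq_bigr => k _ /=.
have -> : m * inversions s =
    \sum_(a < m) \sum_(b < m) \sum_(c < m) ((b < c) && (s c < s b)).
  by rewrite sum_nat_const card_ord.
rewrite -sum_cst3 !big_distrr -!big_split; apply: eq_bigr => a _ /=.
rewrite !big_distrr -!big_split; apply: eq_bigr => b _ /=.
rewrite !big_distrr -!big_split; apply: eq_bigr => c _ /=.
rewrite !tensorE !ltn_cell !(inj_eq perm_inj).
have tauE (x y : 'I_n) : (val (tau x) == val (tau y)) = (val x == val y).
  by rewrite !val_eqE (inj_eq perm_inj).
have := tauE i j; have := tauE i k; have := tauE j k; rewrite /= -!val_eqE /=.
move: (nat_of_ord (tau i)) (nat_of_ord (tau j)) (nat_of_ord (tau k)).
move: (nat_of_ord (s a)) (nat_of_ord (s b)) (nat_of_ord (s c)).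
move: (nat_of_ord a) (nat_of_ord b) (nat_of_ord c).
move: (nat_of_ord i) (nat_of_ord j) (nat_of_ord k).
clear=> i j k a b c sa sb sc ti tj tk.
by case: (ltngtP i j) => ?; case: (ltngtP j k) => ?; case: (ltngtP i k) => ?; lia.
Qed.

End Tensor.

(** * Mean densities in random inflations *)

Section Limits.
Local Set Implicit Arguments.
Local Unset Strict Implicit.
Import Order.TTheory GRing.Theory Num.Theory numFieldNormedType.Exports.
Local Open Scope classical_set_scope.
Local Open Scope ring_scope.

Definition mean (R : realType) (l : nat) (g : 'S_l -> R) : R :=
  (\sum_s g s) / l`!%:R.

(** Almost sure convergence of a bounded sequence implies convergence of the
    expectations, and the expectation of a function of a uniform permutation is
    its mean over the symmetric group. *)
Lemma mean_cvg (R : realType) (d : measure_display) (Omega : measurableType d)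
    (P : probability Omega R) (lambda : forall l, Omega -> 'S_l)
    (g : forall l, 'S_l -> R) (c : R) :
  (forall l, (0 < l)%N -> uniform_permutation P (lambda l)) ->
  (forall l s, 0 <= g l s <= 1) ->
  {ae P, forall w, (fun j => g j.+1 (lambda j.+1 w)) @ \oo --> c} ->
  (fun j => mean (@g j.+1)) @ \oo --> c.
Proof.
move=> unif g01 ae_cvg.
pose X j w := g j.+1 (lambda j.+1 w).
pose F j s w := ((g j.+1 s)%:E * (\1_(lambda j.+1 @^-1` [set s]) w)%:E)%E.
(* Summing over the fibres of [lambda j.+1] yields both the measurability and the
   integral of X from those of indicator functions. *)
have XE j : EFin \o X j = fun w => (\sum_(s : 'S_j.+1) F j s w)%E.
  apply/funext => w; rewrite (bigD1 (lambda j.+1 w)) //= big1 => [|s /eqP ns].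
    by rewrite /F indicE mem_set // mule1 adde0.
  by rewrite /F indicE memNset ?mule0 //= => e; apply: ns.
have mfib j s : measurable (lambda j.+1 @^-1` [set s]).
  by have [] := unif j.+1 isT s.
have mindic j s :
    measurable_fun setT (fun w => (\1_(lambda j.+1 @^-1` [set s]) w)%:E : \bar R).
  exact/measurable_EFinP/measurable_indic.
have mF j s : measurable_fun setT (F j s) by exact: measurable_funeM.
have g0 j s : 0 <= g j s by case/andP: (g01 j s).
have mX j : measurable_fun setT (EFin \o X j).
  by rewrite XE; apply: emeasurable_sum => s; exact: mF.
have intX j : (\int[P]_w (EFin \o X j) w = (mean (@g j.+1))%:E)%E.
  rewrite XE ge0_integral_sum //; last by move=> s w _; rewrite mule_ge0 ?lee_fin.
  rewrite /mean mulr_suml -sumEFin; apply: eq_bigr => s _.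
  rewrite ge0_integralZl_EFin //.
  rewrite integral_indic // setIT EFinM.
  by congr (_ * _)%E; have [_] := unif j.+1 isT s.
have [] := @dominated_convergence _ _ _ P setT measurableT
  (fun j => EFin \o X j) (cst c%:E) (cst 1%E).
- exact: mX.
- exact: measurable_cst.
- by apply: filterS ae_cvg => w cw _; apply: cvg_EFin; first exact: nearW.
- by apply: finite_measure_integrable_cst.
- apply: aeW => w j _.
  by rewrite lee_fin ger0_norm; case/andP: (g01 j.+1 (lambda j.+1 w)).
have intc : (\int[P]_w cst c%:E w = c%:E)%E.
  by rewrite integral_cst // -[RHS]mule1; congr (_ * _)%E; exact: probability_setT.
move=> _ _; rewrite intc.
under eq_fun do rewrite intX.
exact: fine_cvg.
Qed.

Lemma densityE (R : realType) (k N : nat) (p : 'S_k) (T : 'S_N) :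
  density R p T * 'C(N, k)%:R = (occurrences p T)%:R.
Proof.
rewrite /density -/(occurrences p T).
have [bin0|bin_neq0] := eqVneq 'C(N, k) 0%N; last by rewrite divfK // pnatr_eq0.
by have := leq_occurrences p T; rewrite bin0 leqn0 mulr0 => /eqP ->.
Qed.

Lemma density_ge0_le1 (R : realType) (k N : nat) (p : 'S_k) (T : 'S_N) :
  0 <= density R p T <= 1.
Proof.
rewrite /density -/(occurrences p T) divr_ge0 //=.
have [->|bin_neq0] := eqVneq 'C(N, k) 0%N; first by rewrite invr0 mulr0.
by rewrite ler_pdivrMr ?ltr0n ?lt0n // mul1r ler_nat leq_occurrences.
Qed.

Definition mean_density (R : realType) (n : nat) (tau : 'S_n) (k : nat)
    (p : 'S_k) (m : nat) : R :=
  mean (fun s : 'S_m => density R p (tensor tau s)).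

Lemma inflatable_mean_density (R : realType) (k n : nat) (tau : 'S_n) :
  inflatable R k tau ->
  forall p : 'S_k,
    (fun j => mean_density R tau p j.+1) @ \oo --> (k`!%:R^-1 : R).
Proof.
case=> d [T [P [lambda [unif ae_sym]]]] p.
apply: (mean_cvg unif (g := fun l s => density R p (tensor tau s))).
  by move=> l s; exact: density_ge0_le1.
by apply: filterS ae_sym => w [_ _]; exact.
Qed.

Lemma natr_bin3 (R : realType) (N : nat) :
  6 * 'C(N, 3)%:R = N%:R * (N%:R - 1) * (N%:R - 2) :> R.
Proof.
have -> : (6 : R) = (3`!)%:R by [].
rewrite -natrM mulnC bin_ffact !ffactnS ffactn0 muln1.
case: N => [|[|N]] /=; first by rewrite !mul0r.
  by rewrite subrr mulr0 mul0r.
by rewrite !natrM -!natr1; ring.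
Qed.

Lemma natr_mul_pred (R : realType) (m : nat) :
  (m * m.-1)%:R = m%:R * (m%:R - 1) :> R.
Proof. by case: m => [|m]; rewrite ?mul0n ?mul0r // natrM -!natr1 addrK. Qed.

(** The falling factorial of nm replaces the binomial coefficient so that all the
    relations between means are polynomial in m. *)
Lemma mean_density3E (R : realType) (n m : nat) (tau : 'S_n) (p : 'S_3) :
  mean_density R tau p m * ((n * m)%:R * ((n * m)%:R - 1) * ((n * m)%:R - 2)) =
  6 * mean (fun s : 'S_m => (occurrences p (tensor tau s))%:R).
Proof.
rewrite -natr_bin3 /mean_density /mean mulrCA; congr (_ * _).
rewrite mulrAC; congr (_ / _).
by rewrite mulr_suml; apply: eq_bigr => s _; rewrite densityE.
Qed.

Lemma mean_nat (R : realType) (m c x : nat) (g : 'S_m -> nat) :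
  ((\sum_s g s) * c)%N = (m`! * x)%N ->
  c%:R * mean (fun s => (g s)%:R) = x%:R :> R.
Proof.
move=> e; rewrite /mean mulrA -natr_sum -natrM mulnC e natrM mulrC mulKf //.
Qed.

Lemma meanD (R : realType) (m : nat) (g h : 'S_m -> R) :
  mean (fun s => g s + h s) = mean g + mean h.
Proof. by rewrite /mean big_split mulrDl. Qed.

Lemma meanZ (R : realType) (m : nat) (c : R) (g : 'S_m -> R) :
  mean (fun s => c * g s) = c * mean g.
Proof. by rewrite /mean -mulr_sumr mulrA. Qed.

Lemma mean_cst (R : realType) (m : nat) (c : R) : mean (fun _ : 'S_m => c) = c.
Proof.
rewrite /mean sumr_const card_Sn -[c *+ _]mulr_natr mulfK //.
Qed.

Lemma mean_occurrences132_tensor (R : realType) (n m : nat) (tau : 'S_n) :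
  36 * mean (fun s : 'S_m => (occurrences pattern132 (tensor tau s))%:R) =
  36 * m%:R ^+ 3 * (occurrences pattern132 tau)%:R
  + 9 * m%:R ^+ 2 * (m%:R - 1) * (noninversions tau)%:R
  + n%:R * (m%:R * (m%:R - 1) * (m%:R - 2)) :> R.
Proof.
have invE := mean_nat R (sum_inversions m).
have occE := mean_nat R (sum_occurrences m pattern132).
rewrite natr_mul_pred in invE; rewrite -natr_bin3 -occE.
under [in LHS]eq_fun do rewrite occurrences132_tensor !natrD natrM natrX !natrM.
rewrite !meanD !meanZ mean_cst.
have -> : (3`!)%:R = 6 :> R by [].
move: invE; set I := mean _; set O := mean _ => invE.
transitivity (36 * (m%:R ^+ 3 * (occurrences pattern132 tau)%:R) +
  9 * m%:R * (noninversions tau)%:R * (4 * I) + 36 * n%:R * O); first by ring.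
by rewrite invE; ring.
Qed.

Lemma mean_noninversions_tensor (R : realType) (n m : nat) (tau : 'S_n) :
  4 * mean (fun s : 'S_m => (noninversions (tensor tau s))%:R) =
  4 * m%:R ^+ 2 * (noninversions tau)%:R + n%:R * (m%:R * (m%:R - 1)) :> R.
Proof.
rewrite -natr_mul_pred -(mean_nat R (sum_noninversions m)).
under [in LHS]eq_fun do rewrite noninversions_tensor !natrD natrM natrX !natrM.
by rewrite !meanD !meanZ mean_cst; ring.
Qed.

(** The mean over s of the double counting in tau[s]. *)
Lemma sum_mean_density (R : realType) (n m : nat) (tau : 'S_n) :
  2 * (\sum_(p : 'S_3) (noninversions3 (fun i => p i))%:R * mean_density R tau p m) *
    ((n * m)%:R * ((n * m)%:R - 1) * ((n * m)%:R - 2)) =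
  3 * ((n * m)%:R - 2) *
    (4 * m%:R ^+ 2 * (noninversions tau)%:R + n%:R * (m%:R * (m%:R - 1))).
Proof.
rewrite -mean_noninversions_tensor.
set N := (n * m)%:R * _ * _.
transitivity (12 * mean (fun s : 'S_m =>
   \sum_(p : 'S_3) (noninversions3 (fun i => p i))%:R *
     (occurrences p (tensor tau s))%:R) : R).
  rewrite -mulrA mulr_suml (eq_bigr (fun p : 'S_3 =>
    6 * ((noninversions3 (fun i => p i))%:R *
      mean (fun s : 'S_m => (occurrences p (tensor tau s))%:R)))); last first.
    by move=> p _; rewrite -mulrA mean_density3E mulrCA.
  rewrite -mulr_sumr mulrA; congr (_ * _); first by ring.
  rewrite /mean exchange_big /= mulr_suml; apply: eq_bigr => p _.
  by rewrite -mulr_sumr mulrA.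
rewrite (_ : (fun s : 'S_m => _) =
  (fun s : 'S_m => ((n * m)%:R - 2) * (noninversions (tensor tau s))%:R)).
  by rewrite meanZ; ring.
apply/funext => s; have /(congr1 (fun i => i%:R : R)) :=
  sum_noninversions3_occurrences (tensor tau s).
rewrite natrD natr_sum !natrM => /(canRL (addrK _)).
rewrite mulrBl => <-; apply: eq_bigr => p _; by rewrite natrM.
Qed.

Lemma cvg_sub_harmonic (R : realType) (a b : R) :
  (fun j => a - b * harmonic j) @ \oo --> a.
Proof.
rewrite -[X in _ --> X]subr0 -[X in _ - X](mulr0 b).
by apply: cvgB; [exact: cvg_cst|apply: cvgM; [exact: cvg_cst|exact: cvg_harmonic]].
Qed.

(** The six patterns of length 3 have nine noninversions altogether, so the sum
    of the densities weighted by noninversions tends to 9 / 6. After division by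
    m ^ 3, where m is the size of the inflating permutation, [sum_mean_density]
    is polynomial in 1 / m, and its limit is its value at 1 / m = 0. *)
Lemma inflatable_noninversions (R : realType) (n : nat) (tau : 'S_n) :
  (0 < n)%N -> inflatable R 3 tau -> (4 * noninversions tau + n = n ^ 2)%N.
Proof.
move=> n_gt0 /inflatable_mean_density density_cvg.
set P := noninversions tau.
pose h : nat -> R := harmonic.
pose D j := \sum_(p : 'S_3) (noninversions3 (fun i => p i))%:R *
  mean_density R tau p j.+1.
(* The factors 1 make both brackets instances of [cvg_sub_harmonic]. *)
pose L j := 2 * D j * (n%:R * (n%:R - 1 * h j) * (n%:R - 2 * h j)).
have LE : L = fun j => 3 * (n%:R - 2 * h j) * (4 * P%:R + n%:R * (1 - 1 * h j)).
  apply/funext => j; have j0 : j.+1%:R != 0 :> R by rewrite pnatr_eq0.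
  apply: (mulIf (expf_neq0 3 j0)); rewrite /L /h /harmonic /=.
  transitivity (2 * D j *
    ((n * j.+1)%:R * ((n * j.+1)%:R - 1) * ((n * j.+1)%:R - 2))).
    by rewrite natrM; field.
  by rewrite sum_mean_density natrM; field.
have D_cvg : D @ \oo --> (3 / 2 : R).
  have -> : 3 / 2 = \sum_(p : 'S_3) (noninversions3 (fun i => p i))%:R *
      (3`!)%:R^-1 :> R.
    by rewrite -mulr_suml -natr_sum sum_noninversions3 -[3`!]/6%N; field.
  apply: cvg_big; first exact: add_continuous.
  by move=> p _; apply: cvgM; [exact: cvg_cst|exact: density_cvg].
have cvg1 : L @ \oo --> 2 * (3 / 2) * (n%:R * n%:R * n%:R : R).
  apply: cvgM; first by apply: cvgM; [exact: cvg_cst|].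
  apply: cvgM; last exact: cvg_sub_harmonic.
  by apply: cvgM; [exact: cvg_cst|exact: cvg_sub_harmonic].
have cvg2 : L @ \oo --> 3 * n%:R * (4 * P%:R + n%:R * 1 : R).
  rewrite LE; apply: cvgM.
    by apply: cvgM; [exact: cvg_cst|exact: cvg_sub_harmonic].
  apply: cvgD; first exact: cvg_cst.
  by apply: cvgM; [exact: cvg_cst|exact: cvg_sub_harmonic].
have e := cvg_unique (@norm_hausdorff _ R^o) cvg1 cvg2.
apply/eqP; rewrite -(eqr_nat R) natrD natrX natrM; apply/eqP.
have n0 : 3 * n%:R != 0 :> R by rewrite mulf_neq0 // pnatr_eq0 -lt0n.
apply: (mulfI n0); transitivity (3 * n%:R * (4 * P%:R + n%:R * 1) : R); first by ring.
by rewrite -e; field.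
Qed.

(** With denominators cleared, the mean density of 132 in an inflation of tau by
    permutations of size m satisfies a relation that is polynomial in 1 / m, and
    its limit is its value at 1 / m = 0. *)
Lemma inflatable_occurrences132 (R : realType) (n : nat) (tau : 'S_n) :
  inflatable R 3 tau ->
  (36 * occurrences pattern132 tau + 9 * noninversions tau + n = n ^ 3)%N.
Proof.
move=> /inflatable_mean_density/(_ pattern132) density_cvg.
set N := occurrences _ _; set P := noninversions tau.
pose h : nat -> R := harmonic.
(* The factors 1 make both brackets instances of [cvg_sub_harmonic]. *)
pose L j := 6 * mean_density R tau pattern132 j.+1 *
  (n%:R * (n%:R - 1 * h j) * (n%:R - 2 * h j)).
have LE : L = fun j => 36 * N%:R + 9 * P%:R * (1 - 1 * h j) +
    n%:R * ((1 - 1 * h j) * (1 - 2 * h j)).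
  apply/funext => j; have j0 : j.+1%:R != 0 :> R by rewrite pnatr_eq0.
  apply: (mulIf (expf_neq0 3 j0)); rewrite /L /h /harmonic /=.
  transitivity (6 * (mean_density R tau pattern132 j.+1 *
    ((n * j.+1)%:R * ((n * j.+1)%:R - 1) * ((n * j.+1)%:R - 2)))).
    by rewrite natrM; field.
  rewrite mean_density3E mulrA -natrM -[(6 * 6)%N]/36%N mean_occurrences132_tensor.
  by rewrite -/N -/P; field.
have cvg1 : L @ \oo --> 6 * (3`!)%:R^-1 * (n%:R * n%:R * n%:R : R).
  apply: cvgM; first by apply: cvgM; [exact: cvg_cst|exact: density_cvg].
  apply: cvgM; last exact: cvg_sub_harmonic.
  by apply: cvgM; [exact: cvg_cst|exact: cvg_sub_harmonic].
have cvg2 : L @ \oo --> 36 * N%:R + 9 * P%:R * 1 + n%:R * (1 * 1 : R).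
  rewrite LE; apply: cvgD; first apply: cvgD; first exact: cvg_cst.
    by apply: cvgM; [exact: cvg_cst|exact: cvg_sub_harmonic].
  apply: cvgM; first exact: cvg_cst.
  by apply: cvgM; exact: cvg_sub_harmonic.
have e := cvg_unique (@norm_hausdorff _ R^o) cvg1 cvg2.
apply/eqP; rewrite -(eqr_nat R) 2!natrD natrX !natrM; apply/eqP.
transitivity (36 * N%:R + 9 * P%:R * 1 + n%:R * (1 * 1) : R); first by ring.
by rewrite -e -[3`!]/6%N; field.
Qed.

End Limits.

(** * Arithmetic conclusion *)

(** The equation says that n (n - 1) (4 n - 5) = 0 modulo 144; modulo 16 its
    solutions are 0 and 1, and modulo 9 they are 0, 1 and 8. *)
Lemma residues_mod_144 (n x : nat) :
  144 * x + 9 * n ^ 2 = 4 * n ^ 3 + 5 * n ->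
  n %% 144 \in [:: 0; 1; 17; 64; 80; 81].
Proof.
move=> e.
pose root d r := 9 * r ^ 2 == 4 * r ^ 3 + 5 * r %[mod d].
have residue d : d %| 144 -> 0 < d ->
    n %% d \in [seq r <- iota 0 d | root d r].
  move=> /dvdnP[q qd] d_gt0; rewrite mem_filter mem_iota ltn_mod d_gt0 andbT /root.
  have reduce c k : c * (n %% d) ^ k = c * n ^ k %[mod d].
    by rewrite -modnMmr modnXm modnMmr.
  have := reduce 5 1; rewrite !expn1 => reduce5.
  by rewrite reduce -modnDm reduce reduce5 modnDm -e qd mulnAC modnMDl eqxx.
have := residue 9 isT isT; have := residue 16 isT isT.
rewrite (_ : seq.filter _ _ = [:: 0; 1]) // (_ : seq.filter _ _ = [:: 0; 1; 8]) //.
by rewrite !inE; lia.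
Qed.

Theorem lemma15 (R : realType) (n : nat) (hn : (0 < n)%N) (tau : {perm 'I_n})
  (htau : inflatable R 3 tau) :
  (n %% 144)%N \in [:: 0; 1; 17; 64; 80; 81]%N.
Proof.
have eP := inflatable_noninversions hn htau.
have eN := inflatable_occurrences132 htau.
apply: (@residues_mod_144 _ (occurrences pattern132 tau)); lia.
Qed.
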